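(* Let $s>1$, and let $(a_n)_{n=0}^{\infty}$ be a greedy $s$-energy sequence on $S^1$. Then the sequence $$\left(\frac{U_{N,s}(a_N)}{N^s}\right)_{N=1}^{\infty}$$ is bounded and divergent, and we have $$\limsup_{N\to\infty}\frac{U_{N,s}(a_N)}{N^s}=(2^s-1)\frac{2\zeta(s)}{(2\pi)^s},$$ $$\liminf_{N\to\infty}\frac{U_{N,s}(a_N)}{N^s}=\underline{g}(s)(2^s-1)\frac{2\zeta(s)}{(2\pi)^s}.$$ For each $\vec{\theta}\in\Theta$, the value $G(\vec{\theta};s)(2^s-1)\frac{2\zeta(s)}{(2\pi)^s}$ is a limit point of the sequence $\left(\frac{U_{N,s}(a_N)}{N^s}\right)_{N=1}^{\infty}$.
   Context: $S^1=\{z\in\mathbb{C}:|z|=1\}$. For $s>0$, a sequence $(a_n)_{n=0}^{\infty}\subset S^1$ is a greedy $s$-energy sequence on $S^1$ if for every $n\geq 1$, $\sum_{k=0}^{n-1}|a_n-a_k|^{-s}=\inf_{z\in S^1}\sum_{k=0}^{n-1}|z-a_k|^{-s}$ (with $|z-a_k|^{-s}=+\infty$ when $z=a_k$). For $N\geq 1$, $U_{N,s}(z):=\sum_{k=0}^{N-1}|z-a_k|^{-s}$. $\zeta$ is the Riemann zeta function, $\zeta(s)=\sum_{n\geq 1}n^{-s}$ for $s>1$. For an integer $N\geq 1$ let $\tau_b(N)$ be the number of $1$'s in the binary representation of $N$. For an integer $p\geq 1$, $\Theta_p$ is the set of all $\vec{\theta}=(\theta_1,\ldots,\theta_p)\in\mathbb{R}^p$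 for which there is an infinite sequence $\mathcal{N}$ of positive integers such that every $N\in\mathcal{N}$ satisfies $\tau_b(N)=p$ and, writing $N=2^{n_1}+\cdots+2^{n_p}$ with $n_1>\cdots>n_p\geq 0$ (the $n_k$ depending on $N$), $\lim_{N\in\mathcal{N}}2^{n_k}/N=\theta_k$ for all $1\leq k\leq p$. Set $\Theta=\bigcup_{p\geq 1}\Theta_p$, $G(\vec{\theta};s)=\sum_{k=1}^p\theta_k^s$ for $\vec{\theta}=(\theta_1,\ldots,\theta_p)\in\Theta$, and $\underline{g}(s)=\inf_{\vec{\theta}\in\Theta}G(\vec{\theta};s)$ for $s>1$. ''Divergent'' means not convergent; a limit point of a sequence is the limit of some convergent subsequence. *)

(* Defs.v *)
From mathcomp Require Import all_boot all_order all_algebra.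
From mathcomp Require Import complex.
From mathcomp Require Import all_classical all_reals all_analysis.
Set Implicit Arguments.
Unset Strict Implicit.
Unset Printing Implicit Defensive.
Import Order.TTheory GRing.Theory Num.Theory.
Import numFieldNormedType.Exports.
Import Normc.
Local Open Scope classical_set_scope.
Local Open Scope ring_scope.

(* normc is the R-valued modulus on R[i]; the generic norm `|z| has values in
   R[i]. *)
Definition S1 (R : realType) : set R[i] := [set z | normc z = 1].

(* The case distinction is needed: in the library 0 `^ (- s) = 0. *)
Definition riesz_kernel (R : realType) (s : R) (z w : R[i]) : \bar R :=
  if z == w then +oo%E else (normc (z - w) `^ (- s))%:E.

Definition potential (R : realType) (s : R) (a : nat -> R[i]) (N : nat)
    (z : R[i]) : \bar R :=
  (\sum_(k < N) riesz_kernel s z (a k))%E.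

Definition greedy_energy_sequence (R : realType) (s : R) (a : nat -> R[i]) :
    Prop :=
  (forall n, a n \in @S1 R) /\
  (forall n, (1 <= n)%N ->
     potential s a n (a n) = ereal_inf [set potential s a n z | z in @S1 R]).

(* The term of index n corresponds to N = n + 1. *)
Definition normalized_potential (R : realType) (s : R) (a : nat -> R[i])
    (n : nat) : \bar R :=
  (potential s a n.+1 (a n.+1) * ((n.+1%:R `^ s)^-1)%:E)%E.

(* Meaningful for s > 1, where the series converges. *)
Definition zeta (R : realType) (s : R) : R := limn (series (riemannR s)).

(* The digit of weight 2 ^ i vanishes for i >= N, since N < 2 ^ N. *)
Definition tau_b (N : nat) : nat := \sum_(i < N) odd (N %/ 2 ^ i).

(* The infinite set of integers is enumerated increasingly by N_; the exponents
   of the binary expansion of N_ j are e j 0 > e j 1 > ... . *)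
Definition Theta_ (R : realType) (p : nat) : set 'rV[R]_p :=
  [set theta : 'rV[R]_p | exists (N_ : nat -> nat) (e : nat -> 'I_p -> nat),
    [/\ {homo N_ : i j / (i < j)%N},
        forall j, (0 < N_ j)%N /\ tau_b (N_ j) = p,
        forall j, {homo e j : k l / (k < l)%N >-> (l < k)%N},
        forall j, N_ j = (\sum_(k < p) 2 ^ e j k)%N &
        forall k : 'I_p,
          (fun j => (2 ^ e j k)%:R / (N_ j)%:R : R) @ \oo --> theta 0 k]].

Definition Theta (R : realType) : set {p : nat & 'rV[R]_p} :=
  \bigcup_(p in [set p | (1 <= p)%N])
    [set existT (fun p => 'rV[R]_p) p theta | theta in @Theta_ R p].

Definition G (R : realType) (theta : {p : nat & 'rV[R]_p}) (s : R) : R :=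
  \sum_(k < tag theta) tagged theta 0 k `^ s.

Definition g_lower (R : realType) (s : R) : R :=
  inf [set G theta s | theta in @Theta R].

Definition limit_point_seq (R : realType) (u : nat -> \bar R) (l : \bar R) :
    Prop :=
  exists phi : nat -> nat,
    {homo phi : i j / (i < j)%N} /\ (u \o phi) @ \oo --> l.

(* Main.v *)
Require Import Defs.
From mathcomp Require Import all_boot all_order all_algebra.
From mathcomp Require Import complex ring lra zify.
From mathcomp Require Import all_classical all_reals all_analysis.
Set Implicit Arguments.
Unset Strict Implicit.
Unset Printing Implicit Defensive.
Import Order.TTheory GRing.Theory Num.Theory.
Import numFieldNormedType.Exports.
Local Open Scope classical_set_scope.
Local Open Scope ring_scope.

(** Write [U_n] for the potential of the first [n] points. The potential of the
    [M]-th roots of unity attains its minimum over the circle exactly at the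
    [M] midpoints of the arcs between them, because the kernel is strictly
    midpoint convex in the angle and the configuration is symmetric
    ([roots_potential_ge], [roots_potential_argmin]).

    It follows by induction on [n] that, for [M = 2 ^ n], the first [M] points
    of a greedy sequence are a rotation of the [M]-th roots of unity, that the
    next [M] points are midpoints of the first ones, and that these next points
    form a greedy sequence of their own. Indeed the potential to be minimized
    is the sum of the potentials of the two halves; by induction the potential
    of the second half has a minimizer among the midpoints, where the potential
    of the first half is minimal too, so a minimizer of the sum minimizes both
    summands ([greedy_second_half]). Adding up the minima, [U_N (a_N)] is the
    sum, over the binary digits [2 ^ i] of [N], of the potential of the
    [2 ^ i]-th roots of unity at a midpoint ([greedy_potential_value]).

    That midpoint potential, divided by [(2 ^ i) ^ s], tends to
    [C = (2 ^ s - 1) * 2 * zeta s / (2 * pi) ^ s]: the chords scale to the odd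
    multiples of [pi], each counted twice, and dominated convergence applies
    ([cvg_midpoint_potential]). Since the low digits of [N] carry little
    weight, [U_N (a_N) / N ^ s - C * H N] tends to 0, where [H N] is the sum of
    [(2 ^ i / N) ^ s] over the digits of [N] ([scaled_value_asymp]).

    The function [H] never exceeds 1 and equals 1 at powers of two, which gives
    the upper limit. Along a sequence that defines a point of Theta, [H] tends
    to the value of [G] there, which gives the limit points and bounds the lower
    limit from above. Conversely each [H N] is itself a value of [G], attained
    along the integers [2 ^ j * N] ([digit_power_sum_in_G]), which bounds the
    lower limit from below. Finally [H 3 < 1], so the two limits differ. *)

(** * The circle in angular coordinates *)

Definition cis (R : realType) (u : R) : R[i] :=
  (cos (2 * pi * u) +i* sin (2 * pi * u))%C.

(** Angles are measured in turns, so that a chord of angular width [u] has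
    length [2 |sin (pi u)|] and the kernels below have period 1. *)
Definition arc_kernel (R : realType) (s u : R) : R :=
  (2 * `|sin (pi * u)|) `^ (- s).

Definition arc_ekernel (R : realType) (s u : R) : \bar R :=
  if sin (pi * u) == 0 then +oo%E else (arc_kernel s u)%:E.

(** The angle is the arc cosine of the real part, negated on the lower half
    circle. *)
Lemma cis_surj (R : realType) (z : R[i]) : z \in @S1 R -> exists u : R, z = cis u.
Proof.
case: z => x y; rewrite inE /S1 /= => h.
have xy1 : x ^+ 2 + y ^+ 2 = 1.
  by rewrite -[LHS]sqr_sqrtr ?addr_ge0 ?sqr_ge0// h expr1n.
have x1 : -1 <= x <= 1.
  by have := sqr_ge0 y; nra.
have sE : sin (acos x) = `|y|.
  rewrite sin_acos// -sqrtr_sqr; congr Num.sqrt; rewrite -xy1; ring.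
have cE : cos (acos x) = x by rewrite acosK// in_itv.
have p0 : (pi : R) != 0 by rewrite gt_eqF// pi_gt0.
case: (leP 0 y) => y0.
  exists (acos x / (2 * pi)); rewrite /cis mulrC divfK ?mulf_neq0//.
  by rewrite cE sE ger0_norm.
exists (- acos x / (2 * pi)); rewrite /cis mulrC divfK ?mulf_neq0//.
by rewrite cosN sinN cE sE ltr0_norm// opprK.
Qed.

Lemma cis_S1 (R : realType) (u : R) : cis u \in @S1 R.
Proof. by rewrite inE /S1 /cis /= cos2Dsin2 sqrtr1. Qed.

Lemma normc_cisB (R : realType) (u v : R) :
  Normc.normc (cis u - cis v) = 2 * `|sin (pi * (u - v))|.
Proof.
rewrite /cis /=.
set x := 2 * pi * u; set y := 2 * pi * v.
have -> : 2 * `|sin (pi * (u - v))| = `|2 * sin (pi * (u - v))|.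
  by rewrite normrM gtr0_norm.
rewrite -sqrtr_sqr; congr Num.sqrt.
have := cos_mulr2n (pi * (u - v)).
have -> : (pi * (u - v)) *+ 2 = x - y by rewrite /x /y; ring.
rewrite cosB => h.
have := cos2Dsin2 (pi * (u - v)); have := cos2Dsin2 x; have := cos2Dsin2 y.
move: (cos _) (sin _) (cos x) (sin x) (cos y) (sin y) h => c d a b a' b' h *.
nra.
Qed.

Lemma riesz_kernel_cis (R : realType) (s u v : R) :
  riesz_kernel s (cis u) (cis v) = arc_ekernel s (u - v).
Proof.
rewrite /riesz_kernel /arc_ekernel /arc_kernel normc_cisB.
have -> : (cis u == cis v) = (sin (pi * (u - v)) == 0); last by [].
rewrite -subr_eq0 -[RHS]normr_eq0; have h := normc_cisB u v.
apply/eqP/eqP => [e|e]; last by apply: Normc.eq0_normc; rewrite h e mulr0.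
by move: h; rewrite e Normc.normc0 => /esym/eqP; rewrite mulf_eq0 pnatr_eq0 => /eqP.
Qed.

Lemma arc_ekernelD1 (R : realType) (s u : R) :
  arc_ekernel s (u + 1) = arc_ekernel s u.
Proof.
by rewrite /arc_ekernel /arc_kernel mulrDr mulr1 sinDpi oppr_eq0 normrN.
Qed.

Lemma arc_ekernelN (R : realType) (s u : R) :
  arc_ekernel s (- u) = arc_ekernel s u.
Proof.
by rewrite /arc_ekernel /arc_kernel mulrN sinN oppr_eq0 normrN.
Qed.

Lemma arc_ekernel_ge0 (R : realType) (s u : R) : (0 <= arc_ekernel s u)%E.
Proof.
by rewrite /arc_ekernel; case: ifP => // _; rewrite lee_fin powR_ge0.
Qed.

Lemma sinpi_gt0 (R : realType) (u : R) : 0 < u < 1 -> 0 < sin (pi * u).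
Proof.
move=> /andP[u0 u1]; apply: sin_gt0_pi; rewrite mulr_gt0 ?pi_gt0//=.
by rewrite -[ltRHS]mulr1 ltr_pM2l ?pi_gt0.
Qed.

Lemma arc_ekernelE (R : realType) (s u : R) : 0 < u < 1 ->
  arc_ekernel s u = (arc_kernel s u)%:E.
Proof. by move=> /sinpi_gt0 h; rewrite /arc_ekernel gt_eqF. Qed.

(** [sin A * sin B = sin ((A + B) / 2) ^ 2 - sin ((A - B) / 2) ^ 2] bounds the
    geometric mean of two sines by the sine of the mean angle; raising to the
    power [- s] and applying the arithmetic-geometric inequality gives the
    midpoint convexity of the kernel on an open turn, which is strict because
    the subtracted square vanishes only when the two angles agree. *)
Lemma arc_kernel_midpoint_convex (R : realType) (s u v : R) : 0 < s ->
  0 < u < 1 -> 0 < v < 1 ->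
  (arc_kernel s ((u + v) / 2) *+ 2 <= arc_kernel s u + arc_kernel s v) /\
  (u != v ->
   arc_kernel s ((u + v) / 2) *+ 2 < arc_kernel s u + arc_kernel s v).
Proof.
move=> s0 u01 v01.
have m01 : 0 < (u + v) / 2 < 1 by lra.
rewrite /arc_kernel.
have A0 := sinpi_gt0 u01; have B0 := sinpi_gt0 v01; have m0 := sinpi_gt0 m01.
rewrite !gtr0_norm//.
have E : sin (pi * u) * sin (pi * v) =
    sin (pi * ((u + v) / 2)) ^+ 2 - sin (pi * ((u - v) / 2)) ^+ 2.
  have -> : pi * u = pi * ((u + v) / 2) + pi * ((u - v) / 2) by field.
  have -> : pi * v = pi * ((u + v) / 2) - pi * ((u - v) / 2) by field.
  rewrite sinD sinB.
  have := cos2Dsin2 (pi * ((u + v) / 2)); have := cos2Dsin2 (pi * ((u - v) / 2)).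
  move: (cos (pi * ((u - v) / 2))) (sin (pi * ((u - v) / 2))) => a b h1.
  move: (cos (pi * ((u + v) / 2))) (sin (pi * ((u + v) / 2))) => c d h2.
  have -> : (d * a + c * b) * (d * a - c * b) =
     d ^+ 2 * (a ^+ 2 + b ^+ 2) - b ^+ 2 * (c ^+ 2 + d ^+ 2) by ring.
  by rewrite h1 h2 !mulr1.
have sq x : 0 < x -> (2 * x) `^ (- s) = ((2 * x) `^ (- s / 2)) ^+ 2.
  move=> x0; rewrite -powR_mulrn ?powR_ge0// -powRrM.
  by congr (_ `^ _); field.
have mE : (2 * sin (pi * ((u + v) / 2))) `^ (- s) =
   ((4 * sin (pi * ((u + v) / 2)) ^+ 2) `^ (s / 2))^-1.
  rewrite -powRN -mulNr.
  have -> : 4 * sin (pi * ((u + v) / 2)) ^+ 2 =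
     (2 * sin (pi * ((u + v) / 2))) `^ 2%:R.
    rewrite powR_mulrn ?exprMn; [ring|nra].
  by rewrite -powRrM; congr (_ `^ _); field.
move: A0 B0 E; set A := sin (pi * u); set B := sin (pi * v) => A0 B0 E.
(* [x ^ 2 + y ^ 2 >= 2 x y] for the square roots [x], [y] of the kernels *)
have AG : ((4 * (A * B)) `^ (s / 2))^-1 *+ 2 <= (2 * A) `^ (- s) + (2 * B) `^ (- s).
  rewrite (sq A)// (sq B)// -powRN -mulNr.
  have -> : 4 * (A * B) = (2 * A) * (2 * B) by ring.
  rewrite powRM; [|nra|nra].
  move: (_ `^ _) (_ `^ _) => x y; have := sqr_ge0 (x - y); nra.
have AB0 : 0 < 4 * (A * B) by rewrite !mulr_gt0.
have M0 : 0 < 4 * sin (pi * ((u + v) / 2)) ^+ 2 by rewrite mulr_gt0// exprn_gt0.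
have s2 : 0 < s / 2 by rewrite divr_gt0.
rewrite mE; split=> [|uv].
  apply: le_trans AG; rewrite lerMn2r /= lef_pV2 ?posrE ?powR_gt0//.
  apply: ge0_ler_powR; rewrite ?nnegrE ?(ltW s2) ?(ltW AB0) ?(ltW M0)//.
  by rewrite ler_pM2l// E gerBl sqr_ge0.
apply: lt_le_trans AG; rewrite ltrMn2r /= ltf_pV2 ?posrE ?powR_gt0//.
apply: gt0_ltr_powR; rewrite ?nnegrE ?(ltW AB0) ?(ltW M0)//.
rewrite ltr_pM2l// E gtrBl exprn_even_gt0//=.
case: (ltrgtP u v) uv => // h _.
  have /sinpi_gt0 : 0 < (v - u) / 2 < 1 by lra.
  by rewrite -opprB mulNr mulrN sinN oppr_gt0 => /ltr0_neq0.
have /sinpi_gt0 : 0 < (u - v) / 2 < 1 by lra.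
exact: lt0r_neq0.
Qed.

(** * The potential of equally spaced points *)

(** Up to rotation, the potential of the [M]-th roots of unity. *)
Definition roots_potential (R : realType) (s : R) (M : nat) (u : R) : \bar R :=
  (\sum_(j < M) arc_ekernel s (u + j%:R / M%:R))%E.

(** The value of that potential halfway between two consecutive roots. *)
Definition midpoint_potential (R : realType) (s : R) (M : nat) : R :=
  \sum_(j < M) arc_kernel s ((j%:R + 2^-1) / M%:R).

Lemma roots_potentialDV (R : realType) (s : R) (M : nat) (u : R) : (0 < M)%N ->
  roots_potential s M (u + M%:R^-1) = roots_potential s M u.
Proof.
case: M => // m _; rewrite /roots_potential big_ord_recr big_ord_recl /= addeC.
have mR : m.+1%:R != 0 :> R by rewrite pnatr_eq0.
congr (_ + _)%E.
  rewrite mul0r addr0 -[RHS]arc_ekernelD1; congr (arc_ekernel _ _).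
  by move: mR; rewrite -natr1 => mR; field.
apply: eq_bigr => j _; congr (arc_ekernel _ _).
by rewrite /bump /= add1n -[j.+1%:R]natr1; field; rewrite ?natr1 ?nat1r mR.
Qed.

Lemma roots_potentialDz (R : realType) (s : R) (M : nat) (u : R) (m : int) : (0 < M)%N ->
  roots_potential s M (u + m%:~R / M%:R) = roots_potential s M u.
Proof.
move=> M0.
have nat_case (k : nat) v : roots_potential s M (v + k%:R / M%:R) = roots_potential s M v.
  elim: k v => [|k IH] v; first by rewrite mul0r addr0.
  by rewrite -natr1 mulrDl mul1r addrA roots_potentialDV// IH.
case: m => k; first exact: nat_case.
rewrite NegzE mulrNz mulNr -[LHS](nat_case k.+1).
by congr roots_potential; exact: subrK.
Qed.

(** Reversing the order of the roots turns [u] into [1 / M - u]. *)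
Lemma roots_potentialN (R : realType) (s : R) (M : nat) (u : R) : (0 < M)%N ->
  roots_potential s M (- u) = roots_potential s M u.
Proof.
case: M => // m m0; rewrite -[RHS]roots_potentialDV// /roots_potential.
rewrite (reindex_inj rev_ord_inj) /=.
have mR : m.+1%:R != 0 :> R by rewrite pnatr_eq0.
apply: eq_bigr => j _; rewrite -[LHS]arc_ekernelN -[LHS]arc_ekernelD1.
congr (arc_ekernel _ _); rewrite subSS (natrB _ (leq_ord j)).
by move: mR; rewrite -natr1 => mR; field.
Qed.

Lemma root_angle_bounds (R : realType) (M : nat) (x : R) (j : 'I_M) :
  0 < x < M%:R^-1 -> 0 < x + j%:R / M%:R < 1.
Proof.
move=> /andP[x0 x1].
have MR : (0 : R) < M%:R by rewrite ltr0n (leq_ltn_trans _ (ltn_ord j)).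
rewrite ltr_wpDr ?divr_ge0//=.
apply: (@lt_le_trans _ _ (M%:R^-1 + j%:R / M%:R)); first by rewrite ltrD2r.
by rewrite -[X in X + _]mul1r -mulrDl nat1r ler_pdivrMr// mul1r ler_nat.
Qed.

Lemma roots_potentialE (R : realType) (s : R) (M : nat) (u : R) : (0 < M)%N ->
  0 < u < M%:R^-1 ->
  roots_potential s M u = (\sum_(j < M) arc_kernel s (u + j%:R / M%:R))%:E.
Proof.
move=> M0 uM; rewrite -sumEFin; apply: eq_bigr => j _.
by rewrite arc_ekernelE// root_angle_bounds.
Qed.

Lemma arc_decomposition (R : realType) (M : nat) (u : R) : (0 < M)%N ->
  exists (m : int) (v : R), u = v + m%:~R / M%:R /\ 0 <= v < M%:R^-1.
Proof.
move=> M0; have MR : (0 : R) < M%:R by rewrite ltr0n.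
exists (Num.floor (u * M%:R)), (u - (Num.floor (u * M%:R))%:~R / M%:R).
split; first by rewrite subrK.
have /andP[h1 h2] := Num.Theory.floor_itv (u * M%:R).
rewrite subr_ge0 ler_pdivrMr// h1/= ltrBlDr -[X in X + _]mul1r -mulrDl.
by rewrite ltr_pdivlMr// addrC -intrD1.
Qed.

(** On the arc between two consecutive roots the potential is symmetric under
    [v |-> 1 / M - v], and the midpoint of [v] and its image is the middle of
    the arc. Applying midpoint convexity to each root therefore gives twice the
    value at [v] on one side and twice the value at the middle on the other. *)
Lemma roots_potential_arc (R : realType) (s : R) (M : nat) (v : R) : 0 < s -> (0 < M)%N ->
  0 <= v < M%:R^-1 ->
  ((midpoint_potential s M)%:E <= roots_potential s M v)%E /\
  (v != 2^-1 / M%:R -> ((midpoint_potential s M)%:E < roots_potential s M v)%E).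
Proof.
move=> s0 M0 /andP[v0 v1]; have MR : (0 : R) < M%:R by rewrite ltr0n.
have [v0'|{v0}] := leP v 0.
  have {v0 v0'}-> : v = 0 by apply/eqP; rewrite eq_le v0'.
  (* at a root the potential is infinite *)
  suff -> : roots_potential s M 0 = +oo%E by rewrite leey ltey.
  rewrite /roots_potential (bigD1 (Ordinal M0))//= mul0r addr0 {1}/arc_ekernel.
  rewrite mulr0 sin0 eqxx addye// gt_eqF//.
  apply: lt_le_trans (_ : (0 <= _)%E); first exact: ltNyr.
  by apply: sume_ge0 => i _; exact: arc_ekernel_ge0.
move=> v0; rewrite roots_potentialE ?v0//.
have rE : roots_potential s M v = roots_potential s M (M%:R^-1 - v).
  by rewrite -roots_potentialN// -roots_potentialDV// addrC.
set w := M%:R^-1 - v in rE.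
have w01 : 0 < w < M%:R^-1 by rewrite subr_gt0 v1 gtrBl.
move: rE; rewrite !roots_potentialE ?v0// => -[rE].
have mid (j : 'I_M) : (j%:R + 2^-1) / M%:R =
    ((v + j%:R / M%:R) + (w + j%:R / M%:R)) / 2.
  by rewrite /w; field; rewrite gt_eqF.
have v01 : 0 < v < M%:R^-1 by rewrite v0.
have key (j : 'I_M) := arc_kernel_midpoint_convex s0
  (root_angle_bounds j v01) (root_angle_bounds j w01).
rewrite !lee_fin lte_fin; split=> [|vN].
  rewrite -(@ler_pMn2r _ 2%N)// [leRHS]mulr2n {2}rE -big_split -sumrMnl /=.
  by apply: ler_sum => j _; rewrite mid; exact: (key j).1.
rewrite -(@ltr_pMn2r _ 2%N)// [ltRHS]mulr2n {2}rE -big_split -sumrMnl /=.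
apply: ltr_sum => [|j _].
  by apply/hasP; exists (Ordinal M0); rewrite ?mem_index_enum.
rewrite mid; apply: (key j).2; apply: contra vN => /eqP /addIr vw.
apply/eqP; move: vw; rewrite /w => vw; lra.
Qed.

Lemma roots_potential_ge (R : realType) (s : R) (M : nat) (u : R) : 0 < s ->
  (0 < M)%N -> ((midpoint_potential s M)%:E <= roots_potential s M u)%E.
Proof.
move=> s0 M0; have [m [v [-> v01]]] := arc_decomposition u M0.
by rewrite roots_potentialDz//; exact: (roots_potential_arc s0 M0 v01).1.
Qed.

Lemma roots_potential_midpoint (R : realType) (s : R) (M : nat) (m : int) : (0 < M)%N ->
  roots_potential s M ((2^-1 + m%:~R) / M%:R) = (midpoint_potential s M)%:E.
Proof.
move=> M0; have MR : (0 : R) < M%:R by rewrite ltr0n.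
rewrite mulrDl roots_potentialDz// roots_potentialE//; last first.
  rewrite mulr_gt0 ?invr_gt0//= gtr_pMl ?invr_gt0//; lra.
by congr (_%:E); apply: eq_bigr => j _; rewrite -mulrDl addrC.
Qed.

Lemma roots_potential_argmin (R : realType) (s : R) (M : nat) (u : R) : 0 < s ->
  (0 < M)%N -> (roots_potential s M u <= (midpoint_potential s M)%:E)%E ->
  exists m : int, u = (2^-1 + m%:~R) / M%:R.
Proof.
move=> s0 M0; have [m [v [-> v01]]] := arc_decomposition u M0.
rewrite roots_potentialDz// => h; exists m; rewrite mulrDl; congr (_ + _).
apply/eqP; apply: contraLR h => vN; rewrite -ltNge.
exact: (roots_potential_arc s0 M0 v01).2.
Qed.

(** * Sums over binary digits *)

(** The sum of [f i] over the positions [i] of the binary digits 1 of [N]; the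
    bound [i < N] is harmless because [N < 2 ^ N]. *)
Definition digit_sum (V : nmodType) (f : nat -> V) (N : nat) : V :=
  \sum_(i < N | odd (N %/ 2 ^ i)) f i.

Lemma digit_bound (N m i : nat) : (N < 2 ^ m)%N -> odd (N %/ 2 ^ i) -> (i < m)%N.
Proof.
move=> Nm; rewrite ltnNge; apply: contraL => mi; rewrite divn_small//.
by apply: leq_trans Nm _; rewrite leq_exp2l.
Qed.

Lemma digit_sum_widen (V : nmodType) (f : nat -> V) (N m : nat) : (N < 2 ^ m)%N ->
  digit_sum f N = \sum_(i < m | odd (N %/ 2 ^ i)) f i.
Proof.
move=> Nm; pose k := maxn N m.
have widen p : (N < 2 ^ p)%N -> (p <= k)%N ->
    \sum_(i < p | odd (N %/ 2 ^ i)) f i = \sum_(i < k | odd (N %/ 2 ^ i)) f i.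
  move=> Np pk; rewrite (big_ord_widen_cond _ (fun i => odd (N %/ 2 ^ i)) f pk).
  apply: eq_bigl => i; apply: andb_idr; exact: digit_bound.
by rewrite /digit_sum !widen// ?leq_maxl ?leq_maxr// ltn_expl.
Qed.

Lemma digit_sum0 (V : nmodType) (f : nat -> V) : digit_sum f 0 = 0.
Proof. by rewrite /digit_sum big_ord0. Qed.

(** Adding a leading digit is the step of the inductions on binary expansions;
    it mirrors the passage from the first [2 ^ n] greedy points to the next
    ones. *)
Lemma digit_sum_pow2D (V : nmodType) (f : nat -> V) (n l : nat) : (l < 2 ^ n)%N ->
  digit_sum f (2 ^ n + l) = f n + digit_sum f l.
Proof.
move=> ln.
have lt1 : (2 ^ n + l < 2 ^ n.+1)%N by rewrite expnS mul2n -addnn ltn_add2l.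
rewrite (digit_sum_widen _ lt1) (digit_sum_widen _ ln) big_mkcond big_ord_recr /= addrC.
rewrite divnDl// divnn expn_gt0/= divn_small// addn0; congr (_ + _).
rewrite [RHS]big_mkcond; apply: eq_bigr => i _; congr (if _ then _ else _).
rewrite divnDl ?dvdn_exp2l// 1?ltnW// -expnB// 1?ltnW//.
by rewrite oddD oddX /= orbF subn_eq0 leqNgt ltn_ord.
Qed.

(** * Structure of greedy sequences *)

Definition arc_potential (R : realType) (s : R) (t : nat -> R) (n : nat)
    (v : R) : \bar R :=
  (\sum_(k < n) arc_ekernel s (v - t k))%E.

Definition greedy_upto (R : realType) (s : R) (t : nat -> R) (k : nat) : Prop :=
  forall m, (0 < m < k)%N ->
    forall v, (arc_potential s t m (t m) <= arc_potential s t m v)%E.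

(** The value that the potential takes at the next greedy point. *)
Definition greedy_value (R : realType) (s : R) (N : nat) : R :=
  digit_sum (fun n => midpoint_potential s (2 ^ n)) N.

Lemma arc_potentialD (R : realType) (s : R) (t : nat -> R) (m n : nat) (v : R) :
  arc_potential s t (m + n) v =
  (arc_potential s t m v + arc_potential s (fun j => t (m + j)%N) n v)%E.
Proof. by rewrite /arc_potential big_split_ord. Qed.

Lemma big_ord_double (T : Type) (idx : T) (op : Monoid.com_law idx)
    (f : nat -> T) (M : nat) :
  \big[op/idx]_(j < M + M) f j =
  \big[op/idx]_(j < M) op (f j.*2) (f j.*2.+1).
Proof.
elim: M => [|M IH]; first by rewrite !big_ord0.
by rewrite addnn doubleS !big_ord_recr /= -addnn IH -Monoid.mulmA.
Qed.

(** The [2M]-th roots of unity are the [M]-th roots and their midpoints. *)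
Lemma roots_potential_double (R : realType) (s : R) (M : nat) (u : R) : (0 < M)%N ->
  roots_potential s (M + M) u =
  (roots_potential s M u + roots_potential s M (u + 2^-1 / M%:R))%E.
Proof.
move=> M0; have MR : M%:R != 0 :> R by rewrite pnatr_eq0 -lt0n.
rewrite /roots_potential (big_ord_double _
  (fun j => arc_ekernel s (u + j%:R / (M + M)%:R))) big_split /= natrD -mulr2n -mulr_natl.
congr (_ + _)%E; apply: eq_bigr => j _; congr (arc_ekernel _ _).
  by rewrite -mul2n natrM; field.
by rewrite -natr1 -mul2n natrM; field.
Qed.

(** When two functions have a common minimizer, a point that minimizes their
    sum minimizes each of them; [a] and [b] are the two minima. *)
Lemma lee_add_split (R : realType) (a b : R) (x y : \bar R) :
  (a%:E <= x)%E -> (b%:E <= y)%E -> (x + y <= (a + b)%:E)%E ->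
  (x <= a%:E)%E /\ (y <= b%:E)%E.
Proof.
case: x y => [x| |] [y| |]; rewrite ?lee_fin //= => ax b_y xy; split; lra.
Qed.

(** The induction hypothesis on the first [2 ^ n] points. The point that
    attains the minimum is required to lie among the rotated [2 ^ n]-th roots
    of unity: at the next level this is what makes it a minimizer of the
    potential of the first half as well. Exhibiting it also spares a
    compactness argument. The first clause records the complete configuration
    through its potential alone, which avoids an explicit bijection with the
    roots. *)
Definition greedy_structure (R : realType) (s : R) (n : nat) : Prop :=
  forall (t : nat -> R) (k : nat), greedy_upto s t k ->
  (k = (2 ^ n)%N -> forall v,
     arc_potential s t k v = roots_potential s (2 ^ n) (v - t 0%N)) /\
  ((0 < k < 2 ^ n)%N -> exists m : int,
     arc_potential s t k (t 0%N + m%:~R / (2 ^ n)%:R) = (greedy_value s k)%:E /\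
     forall v, ((greedy_value s k)%:E <= arc_potential s t k v)%E).

Lemma greedy_value_pow2D (R : realType) (s : R) (n l : nat) : (l < 2 ^ n)%N ->
  greedy_value s (2 ^ n + l) = midpoint_potential s (2 ^ n) + greedy_value s l.
Proof. exact: digit_sum_pow2D. Qed.

Section Doubling.
Variables (R : realType) (s : R) (n : nat).
Hypotheses (s0 : 0 < s) (IH : greedy_structure s n).
Let M := (2 ^ n)%N.
Let M0 : (0 < M)%N. Proof. by rewrite expn_gt0. Qed.

Lemma greedy_first_half (t : nat -> R) (k : nat) : greedy_upto s t k ->
  (M <= k)%N -> forall v, arc_potential s t M v = roots_potential s M (v - t 0%N).
Proof.
move=> gt Mk; apply: (IH _).1 => // m /andP[m0 mM]; apply: gt.
by rewrite m0 (leq_trans mM).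
Qed.

Lemma greedy_half_point (t : nat -> R) (k : nat) : greedy_upto s t k ->
  (M < k)%N -> exists m : int, t M = t 0%N + (2^-1 + m%:~R) / M%:R.
Proof.
move=> gt Mk; have half := greedy_first_half gt (ltnW Mk).
have [|m tE] := @roots_potential_argmin R s M (t M - t 0%N) s0 M0; last first.
  by exists m; rewrite -tE addrC subrK.
rewrite -half -(roots_potential_midpoint s 0 M0).
have := gt M _ (t 0%N + (2^-1 + 0%:~R) / M%:R); rewrite M0 Mk => /(_ isT).
by rewrite [leRHS]half addrAC subrr add0r.
Qed.

(** The minimizer provided by the induction hypothesis for the second half lies
    among the midpoints of the first half, hence minimizes both summands. *)
Lemma greedy_second_half_step (t : nat -> R) (l : nat) : (0 < l < M)%N ->
  greedy_upto s t (M + l) -> greedy_upto s (fun j => t (M + j)%N) l ->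
  exists m : int,
    arc_potential s t (M + l) (t 0%N + (2^-1 + m%:~R) / M%:R) =
      (greedy_value s (M + l))%:E.
Proof.
move=> lM gt gb; have /andP[l0 l1] := lM.
have half := greedy_first_half gt (leq_addr _ _).
have [|m tM] := greedy_half_point gt; first by rewrite -addn1 leq_add2l.
have [m' [zE zmin]] := (IH gb).2 lM; exists (m + m').
rewrite arc_potentialD half greedy_value_pow2D// EFinD -zE.
congr (_ + _)%E; first by rewrite addrAC subrr add0r roots_potential_midpoint.
congr arc_potential; rewrite addn0 tM intrD -!addrA !mulrDl.
by rewrite !addrA.
Qed.

Lemma greedy_second_half_ge (t : nat -> R) (l : nat) : (0 < l < M)%N ->
  greedy_upto s t (M + l) -> greedy_upto s (fun j => t (M + j)%N) l ->
  forall v, ((greedy_value s (M + l))%:E <= arc_potential s t (M + l) v)%E.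
Proof.
move=> lM gt gb v; have /andP[l0 l1] := lM.
have half := greedy_first_half gt (leq_addr _ _).
have [m' [zE zmin]] := (IH gb).2 lM.
by rewrite arc_potentialD half greedy_value_pow2D// EFinD leeD// roots_potential_ge.
Qed.

(** Each new point minimizes the sum of the potentials of the two halves, which
    have a common minimizer, so it minimizes the potential of the second half
    alone: the second half is itself greedy. *)
Lemma greedy_second_half (t : nat -> R) (l : nat) : (l <= M)%N ->
  greedy_upto s t (M + l) -> greedy_upto s (fun j => t (M + j)%N) l.
Proof.
elim: l => [|l IHl] lM gt; first by move=> m; rewrite ltn0 andbF.
have gb : greedy_upto s (fun j => t (M + j)%N) l.
  apply: IHl => [|m /andP[m0 ml]]; first exact: ltnW.
  by apply: gt; rewrite m0 (leq_trans ml)// addnS.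
have gt' : greedy_upto s t (M + l).
  by move=> m /andP[m0 ml]; apply: gt; rewrite m0 (leq_trans ml)// addnS.
move=> m; rewrite ltnS [(m <= l)%N]leq_eqVlt => /andP[m0 /predU1P[mE|ml]]; last first.
  by apply: gb; rewrite m0.
move: m0; rewrite {m}mE => m0 v; have lM' : (0 < l < M)%N by rewrite m0.
have [m' [_ zmin]] := (IH gb).2 lM'; apply: le_trans (zmin v).
have [k kE] := greedy_second_half_step lM' gt' gb.
have := gt (M + l)%N _ (t 0%N + (2^-1 + k%:~R) / M%:R).
rewrite addn_gt0 M0 addnS leqnn => /(_ isT); rewrite kE.
rewrite arc_potentialD (greedy_first_half gt' (leq_addr _ _)).
rewrite greedy_value_pow2D// => /lee_add_split[]//.
exact: roots_potential_ge.
Qed.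

(** Below [M] points the previous level applies, after [M] points the minimizer
    is a midpoint, and beyond that the two halves share a minimizer. *)
Lemma greedy_structureS : greedy_structure s n.+1.
Proof.
move=> t k gt; have MM : (2 ^ n.+1 = M + M)%N by rewrite expnS mul2n addnn.
have MR : M%:R != 0 :> R by rewrite pnatr_eq0 -lt0n.
have MR2 : M%:R + M%:R != 0 :> R by rewrite -mulr2n mulrn_eq0.
rewrite MM; split=> [kE v|/andP[k0 kM]].
  move: gt; rewrite {}kE => gt.
  have gb := greedy_second_half (leqnn _) gt.
  have [|m tM] := greedy_half_point gt; first by rewrite -addn1 leq_add2l.
  rewrite arc_potentialD (greedy_first_half gt (leq_addr _ _)).
  rewrite (IH gb).1// roots_potential_double//; congr (_ + _)%E.
  rewrite addn0 tM -[RHS](roots_potentialDz s _ (- m - 1) M0); congr roots_potential.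
  by rewrite intrB intrN; field.
have [kltM|Mk] := ltnP k M.
  have [|m [zE zmin]] := (IH gt).2; first by rewrite k0.
  exists (m * 2); split=> //; rewrite -zE natrD intrM; congr arc_potential.
  by field; rewrite ?MR ?MR2.
have [l kE] : exists l, k = (M + l)%N by exists (k - M)%N; rewrite subnKC.
move: kM gt; rewrite {k k0 Mk}kE ltn_add2l => lM gt.
have [l0|l0] := posnP l.
  have half := greedy_first_half gt (leq_addr _ _).
  rewrite l0 greedy_value_pow2D ?expn_gt0// /greedy_value digit_sum0 addr0 addn0.
  exists 1; rewrite half; split=> [|v]; last by rewrite half roots_potential_ge.
  rewrite -(roots_potential_midpoint s 0 M0); congr roots_potential.
  by rewrite natrD; field; rewrite ?MR ?MR2.
have lM' : (0 < l < M)%N by rewrite l0.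
have gb := greedy_second_half (ltnW lM) gt.
have [m mE] := greedy_second_half_step lM' gt gb.
exists (1 + m * 2); split; last exact: greedy_second_half_ge.
rewrite -mE natrD intrD intrM; congr arc_potential; by field; rewrite ?MR ?MR2.
Qed.

End Doubling.

Lemma greedy_structureP (R : realType) (s : R) (n : nat) : 0 < s ->
  greedy_structure s n.
Proof.
move=> s0; elim: n => [|n IH]; last exact: greedy_structureS.
move=> t k _; rewrite expn0; split=> [-> v|]; last by case: k => [|[]].
by rewrite /arc_potential /roots_potential !big_ord1 /= mul0r addr0.
Qed.

(** Whatever choices the greedy rule leaves open, the value of the potential at
    the new point depends on [N] only, through its binary digits. *)
Lemma greedy_potential_value (R : realType) (s : R) (a : nat -> R[i]) :
  0 < s -> greedy_energy_sequence s a ->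
  forall N, (0 < N)%N -> potential s a N (a N) = (greedy_value s N)%:E.
Proof.
move=> s0 [aS ainf] N N0.
have [t tE] : exists t : nat -> R, forall n, a n = cis (t n).
  by have [t tE] := choice (fun n => cis_surj (aS n)); exists t.
have potE n v : potential s a n (cis v) = arc_potential s t n v.
  by apply: eq_bigr => k _; rewrite tE riesz_kernel_cis.
have gt k : greedy_upto s t k.
  move=> m /andP[m0 _] v; rewrite -!potE -tE ainf//.
  by apply: ereal_inf_lbound; exists (cis v) => //; exact/set_mem/cis_S1.
have [|m [zE zmin]] := (greedy_structureP N s0 (gt N)).2.
  by rewrite N0 ltn_expl.
apply/eqP; rewrite tE potE eq_le zmin andbT -zE.
by apply: (gt N.+1); rewrite N0 ltnSn.
Qed.

(** * The zeta series *)

Lemma series_ord (V : zmodType) (u : nat -> V) (n : nat) :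
  series u n = \sum_(i < n) u i.
Proof. by rewrite /series /= big_mkord. Qed.

Lemma riemannR_double (R : realType) (s : R) (j : nat) :
  riemannR s j.*2.+1 = 2 `^ (- s) * riemannR s j.
Proof.
by rewrite /riemannR -doubleS -mul2n natrM powRM// invfM powRN.
Qed.

Lemma riemannR_noninc (R : realType) (s : R) (i j : nat) : 0 <= s ->
  (i <= j)%N -> riemannR s j <= riemannR s i.
Proof.
move=> s0 ij; rewrite /riemannR lef_pV2 ?posrE ?powR_gt0//.
by apply: ge0_ler_powR; rewrite ?nnegrE ?ler_nat ?ler0n.
Qed.

Lemma series_riemannR_ndecr (R : realType) (s : R) : 0 <= s ->
  nondecreasing_seq (series (riemannR s)).
Proof.
move=> s0; apply/nondecreasing_seqP => n.
by rewrite -subr_ge0 seriesSB ltW// riemannR_gt0.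
Qed.

Lemma powR2N_lt1 (R : realType) (x : R) : 0 < x -> 2 `^ (- x) < 1.
Proof.
move=> x0; rewrite powRN invf_lt1 ?powR_gt0//.
have h := @gt0_ltr_powR R x x0 1 2; rewrite powR1 in h.
by apply: h; rewrite ?nnegrE ?ltr1n.
Qed.

(** Condensation: bounding the term of each odd integer above 1 by that of the
    even integer before it gives [A m <= A (2 m + 1) <= 1 + 2 ^ (1 - s) * A m] for the partial sums
    [A], which bounds them. *)
Lemma is_cvg_series_riemannR (R : realType) (s : R) : 1 < s ->
  cvgn (series (riemannR s)).
Proof.
move=> s1; have s0 : 0 <= s by apply: ltW; apply: lt_trans s1.
have nd := series_riemannR_ndecr s0.
pose q : R := 2 `^ (- s) *+ 2.
have q1 : q < 1.
  have -> : q = 2 `^ (- (s - 1)).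
    rewrite /q opprB powRB ?pnatr_eq0 ?implybT// powRr1// powRN mulrC.
    by rewrite mulr_natr.
  by rewrite powR2N_lt1// subr_gt0.
apply: nondecreasing_is_cvgn => //; exists (1 - q)^-1 => _ [m _ <-].
rewrite -[leRHS]mul1r ler_pdivlMr ?subr_gt0// mulrBr mulr1 lerBlDr.
have: series (riemannR s) m <= series (riemannR s) (m + m).+1.
  by apply: nd; rewrite leqW// leq_addr.
move/le_trans; apply; rewrite !series_ord big_ord_recl {1}/riemannR powR1 invr1 lerD2l.
rewrite (big_ord_double _ (fun j => riemannR s j.+1)) mulr_suml.
apply: ler_sum => j _.
have -> : riemannR s j * q = riemannR s j.*2.+1 *+ 2.
  by rewrite riemannR_double /q mulrnAr mulrC.
by rewrite mulr2n lerD2l; apply: riemannR_noninc.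
Qed.

(** The terms at even integers add up to [2 ^ (- s) * zeta s]. *)
Lemma odd_zeta (R : realType) (s : R) : 1 < s ->
  (fun m => \sum_(j < m) riemannR s j.*2) @ \oo --> (1 - 2 `^ (- s)) * zeta s.
Proof.
move=> s1; have cz := is_cvg_series_riemannR s1.
have -> : (fun m => \sum_(j < m) riemannR s j.*2) =
    (fun m => series (riemannR s) (2 * m)%N - 2 `^ (- s) * series (riemannR s) m).
  apply/funext => m; rewrite mul2n -addnn !series_ord.
  rewrite (big_ord_double _ (riemannR s)) big_split /= mulr_sumr.
  rewrite -[LHS]addr0 -addrA; congr (_ + _); apply/esym/eqP; rewrite subr_eq0.
  by apply/eqP; apply: eq_bigr => j _; rewrite -riemannR_double.
rewrite mulrBl mul1r; apply: cvgB; last by apply: cvgM; [exact: cvg_cst|exact: cz].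
by apply: cvg_comp cz; exact: cvg_mulnl.
Qed.

(** * Asymptotics of the midpoint potential *)

(** Tannery's theorem with limit zero: the terms past a large index are bounded
    by a small tail of the dominating series, and the finitely many remaining
    ones tend to zero. *)
Lemma dominated_sum_cvg0 (R : realType) (d : nat -> nat -> R) (h : nat -> R)
    (m : nat -> nat) :
  (forall j, d^~ j @ \oo --> 0) ->
  (forall n j, (j < m n)%N -> `|d n j| <= h j) ->
  (forall j, 0 <= h j) -> cvgn (series h) ->
  (fun n => \sum_(j < m n) d n j) @ \oo --> 0.
Proof.
move=> d0 dh h0 ch; apply/cvgr0Pnorm_le => e e0.
have nd : nondecreasing_seq (series h).
  by apply/nondecreasing_seqP => n; rewrite -subr_ge0 seriesSB.
have [J _ HJ] : \forall n \near \oo, `|limn (series h) - series h n| <= e / 2.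
  by move/cvgrPdist_le : ch; apply; rewrite divr_gt0.
have tail k : \sum_(J <= j < k) h j <= e / 2.
  have [kJ|Jk] := leqP k J; first by rewrite big_geq// divr_ge0// ltW.
  apply: le_trans (HJ J (leqnn J)).
  rewrite ger0_norm; last by rewrite subr_ge0; exact: nondecreasing_cvgn_le.
  rewrite lerBrDl; apply: le_trans (nondecreasing_cvgn_le nd ch k).
  by rewrite /series/= (big_cat_nat (leq0n J) (ltnW Jk)).
have head : (fun n => \sum_(j < J) `|d n j|) @ \oo --> 0.
  rewrite [X in _ --> X](_ : 0 = \sum_(j < J) (0 : R)); last by rewrite big1.
  apply: (cvg_big add_continuous) => j _.
  by have /cvg_norm := d0 j; rewrite normr0.
have e2 : 0 < e / 2 by rewrite divr_gt0.
have /cvgr0Pnorm_le /(_ _ e2) := head.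
apply: filterS => n; rewrite ger0_norm ?sumr_ge0// => hn.
apply: le_trans (ler_norm_sum _ _ _) _.
rewrite (splitr e) -(big_mkord xpredT (fun j => `|d n j|)).
have [mJ|Jm] := leqP (m n) J.
  rewrite -[leLHS]addr0; apply: lerD; last exact: ltW.
  apply: le_trans hn; rewrite -(big_mkord xpredT (fun j => `|d n j|)).
  by rewrite [leRHS](big_cat_nat (leq0n (m n)) mJ)//= lerDl sumr_ge0.
rewrite (big_cat_nat (leq0n J) (ltnW Jm))//=; apply: lerD; first by rewrite big_mkord.
apply: le_trans (tail (m n)).
by rewrite !big_nat; apply: ler_sum => j /andP[_ jm]; exact: dh.
Qed.

(** The mean value theorem writes [sin t] as [t * cos c] with [0 < c < t]. *)
Lemma sin_bounds (R : realType) (t : R) : 0 < t < pi / 2 ->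
  t * cos t <= sin t <= t.
Proof.
move=> /andP[t0 t1].
have [c ct E] : exists2 c : R, c \in `]0, t[ & sin t - sin 0 = cos c * (t - 0).
  apply: MVT => //.
  by apply: continuous_subspaceT; exact: continuous_sin.
move: ct E; rewrite in_itv /= sin0 !subr0 => /andP[c0 ct] ->.
have p0 := @pi_gt0 R.
have ctc : cos t < cos c by rewrite ltr_cos// ?in_itv/=; lra.
have := cos_le1 c; nra.
Qed.

(** Doubling the angle in [sin_bounds] gives [sin t >= t * (1 + cos t) / 2],
    a linear bound that does not degenerate at [pi / 2]. *)
Lemma sin_ge_half (R : realType) (t : R) : 0 < t < pi / 2 -> t / 2 <= sin t.
Proof.
move=> t01; have p0 := @pi_gt0 R.
have h01 : 0 < t / 2 < pi / 2 by lra.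
have /andP[h1 _] := sin_bounds h01.
have c0 : 0 <= cos t by apply: cos_ge0_pihalf; lra.
have ch : 0 <= cos (t / 2) by apply: cos_ge0_pihalf; lra.
have tE : t = t / 2 *+ 2 by rewrite -mulr_natr divfK.
have := cos_mulr2n (t / 2); have := sin_mulr2n (t / 2); rewrite -tE => -> cE.
nra.
Qed.

Lemma cvg_powR (R : realType) (r l : R) (u : nat -> R) : 0 < l ->
  u @ \oo --> l -> (fun n => u n `^ r) @ \oo --> l `^ r.
Proof.
move=> l0 ul; have lc : {for l, continuous (fun x : R => x `^ r)}.
  apply: differentiable_continuous; apply/derivable1_diffP.
  by apply: derivable_powR; rewrite in_itv /= l0.
exact: cvg_comp ul lc.
Qed.

(** The two halves of the circle contribute equally. *)
Lemma midpoint_potential_double (R : realType) (s : R) (m : nat) : (0 < m)%N ->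
  midpoint_potential s (m + m) =
  2 * \sum_(j < m) arc_kernel s ((j%:R + 2^-1) / (m + m)%:R).
Proof.
move=> m0; have mR : m%:R != 0 :> R by rewrite pnatr_eq0 -lt0n.
have mR2 : m%:R + m%:R != 0 :> R by rewrite -mulr2n mulrn_eq0.
rewrite /midpoint_potential big_split_ord mulr_natl mulr2n /=; congr (_ + _).
rewrite (reindex_inj rev_ord_inj) /=; apply: eq_bigr => j _.
rewrite /arc_kernel -[in RHS]normrN -sinN -[in RHS]normrN -sinDpi.
congr ((2 * `|sin _|) `^ _).
by rewrite 2!natrD (natrB _ (ltn_ord j)) -[j.+1%:R]natr1; field; rewrite ?mR ?mR2.
Qed.

(** The chord from a midpoint to the [j]-th next of the [2m]-th roots of unity,
    multiplied by [2m]. *)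
Definition scaled_chord (R : realType) (j m : nat) : R :=
  (4 * m%:R) * sin (pi * (2 * j%:R + 1) / (4 * m%:R)).

Lemma chord_angle (R : realType) (j m : nat) : (j < m)%N ->
  0 < (pi : R) * (2 * j%:R + 1) / (4 * m%:R) < pi / 2.
Proof.
move=> jm; have m0 : (0 : R) < m%:R by rewrite ltr0n (leq_ltn_trans _ jm).
have p0 := @pi_gt0 R; have j0 : (0 : R) <= j%:R by rewrite ler0n.
have jm' : j%:R + 1 <= m%:R :> R by rewrite natr1 ler_nat.
have j1 : (0 : R) < 2 * j%:R + 1 by lra.
apply/andP; split; first by rewrite divr_gt0 ?mulr_gt0.
by rewrite ltr_pdivrMr ?mulr_gt0// -mulrA ltr_pM2l//; lra.
Qed.

Lemma scaled_chord_bounds (R : realType) (j m : nat) : (j < m)%N ->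
  let c : R := pi * (2 * j%:R + 1) in
  c * cos (c / (4 * m%:R)) <= scaled_chord R j m <= c /\ c / 2 <= scaled_chord R j m.
Proof.
move=> jm c; have m0 : (0 : R) < m%:R by rewrite ltr0n (leq_ltn_trans _ jm).
have jmr := chord_angle R jm; rewrite -/c in jmr.
have m4 : (0 : R) < 4 * m%:R by rewrite mulr_gt0.
have /andP[h1 h2] := sin_bounds jmr; have h3 := sin_ge_half jmr.
rewrite /scaled_chord -/c.
have cE : c = (4 * m%:R) * (c / (4 * m%:R)) by rewrite mulrC divfK// gt_eqF.
split; first (apply/andP; split).
- by rewrite {1}cE -mulrA ler_pM2l.
- by rewrite {2}cE ler_pM2l.
- by rewrite {1}cE -mulrA ler_pM2l.
Qed.

Lemma cvg_scaled_chord (R : realType) (j : nat) :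
  scaled_chord R j @ \oo --> (pi : R) * (2 * j%:R + 1).
Proof.
set c : R := pi * (2 * j%:R + 1).
apply: (@squeeze_cvgr _ _ _ _ (fun m => c * cos (c / (4 * m%:R))) (fun=> c)).
- exists j.+1 => //= m jm; exact: (scaled_chord_bounds R jm).1.
- rewrite (_ : nbhs c = nbhs (c * cos 0)); last by rewrite cos0 mulr1.
  apply: cvgM; first exact: cvg_cst.
  have y0 : (fun m : nat => c / (4 * m%:R)) @ \oo --> 0.
    have h : (fun m : nat => (m%:R : R)^-1) @ \oo --> 0.
      by rewrite -cvg_shiftS; exact: cvg_harmonic.
    have -> : (fun m : nat => c / (4 * m%:R)) = (fun m => c / 4 * m%:R^-1).
      by apply/funext => m; rewrite invfM mulrA.
    by rewrite -(mulr0 (c / 4)); apply: cvgM h; exact: cvg_cst.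
  have c0 : {for 0, continuous (@cos R)} := @continuous_cos R 0.
  exact: cvg_comp y0 c0.
- exact: cvg_cst.
Qed.

Lemma arc_kernel_scaled (R : realType) (s : R) (j m : nat) : (j < m)%N ->
  arc_kernel s ((j%:R + 2^-1) / (m + m)%:R) / (m + m)%:R `^ s =
  scaled_chord R j m `^ (- s).
Proof.
move=> jm; have m0 : (0 : R) < m%:R by rewrite ltr0n (leq_ltn_trans _ jm).
rewrite -powRN /arc_kernel -powRM ?mulr_ge0//.
have -> : pi * ((j%:R + 2^-1) / (m + m)%:R) = pi * (2 * j%:R + 1) / (4 * m%:R) :> R.
  have mm : m%:R + m%:R != 0 :> R by rewrite gt_eqF// addr_gt0.
  by rewrite natrD; field; rewrite mm gt_eqF.
have jmr := chord_angle R jm.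
rewrite gtr0_norm; last by apply: sin_gt0_pihalf.
by rewrite natrD /scaled_chord; congr (_ `^ _); ring.
Qed.

(** The limit of [U_N (a_N) / N ^ s] along the powers of two. *)
Definition midpoint_constant (R : realType) (s : R) : R :=
  (2 `^ s - 1) * (2 * zeta s / (2 * pi) `^ s).

(** After scaling, the [j]-th chord gives a term that tends to
    [(pi * (2 j + 1)) ^ (- s)] and is dominated by [(j + 1) ^ (- s)], because
    [sin t >= t / 2] and [pi >= 2]. So the sum tends to [2 * pi ^ (- s)] times
    the sum over odd integers, which is [(1 - 2 ^ (- s)) * zeta s]. *)
Lemma cvg_midpoint_potential (R : realType) (s : R) : 1 < s ->
  (fun m => midpoint_potential s (m + m) / (m + m)%:R `^ s) @ \oo -->
  midpoint_constant s.
Proof.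
move=> s1; have s0 : 0 < s by apply: lt_trans s1.
have p0 := @pi_gt0 R.
pose d m j := scaled_chord R j m `^ (- s) - pi `^ (- s) * riemannR s j.*2.
have gE j : pi `^ (- s) * riemannR s j.*2 = (pi * (2 * j%:R + 1)) `^ (- s).
  rewrite powRM ?(ltW p0) ?addr_ge0 ?mulr_ge0//.
  by congr (_ * _); rewrite powRN /riemannR -natr1 -mul2n natrM.
have c0 j : 0 < pi * (2 * j%:R + 1) :> R.
  by rewrite mulr_gt0// ltr_wpDl// mulr_ge0.
have dcvg : (fun m => \sum_(j < m) d m j) @ \oo --> 0.
  apply: (@dominated_sum_cvg0 _ d (riemannR s) id).
  - move=> j; rewrite /d -(subrr (pi `^ (- s) * riemannR s j.*2)).
    apply: cvgB; last exact: cvg_cst.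
    by rewrite gE; apply: cvg_powR => //; exact: cvg_scaled_chord.
  - move=> m j jm; have [/andP[_ h2] h3] := scaled_chord_bounds R jm.
    have S0 : 0 < scaled_chord R j m by apply: lt_le_trans h3; rewrite divr_gt0.
    rewrite /d gE !powRN ger0_norm.
      apply: le_trans (_ : (scaled_chord R j m `^ s)^-1 <= _).
        by rewrite gerBl invr_ge0 powR_ge0.
      rewrite /riemannR lef_pV2 ?posrE ?powR_gt0//.
      apply: ge0_ler_powR; rewrite ?nnegrE ?ler0n ?(ltW s0) ?(ltW S0)//.
      apply: le_trans h3.
      by rewrite -[j.+1%:R]natr1; have := @pi_ge2 R; have : (0 : R) <= j%:R by []; nra.
    rewrite subr_ge0 lef_pV2 ?posrE ?powR_gt0//.
    by apply: ge0_ler_powR; rewrite ?nnegrE ?(ltW s0) ?(ltW S0) ?(ltW (c0 j)).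
  - by move=> j; rewrite ltW// riemannR_gt0// ltW.
  - exact: is_cvg_series_riemannR.
have gcvg : (fun m => pi `^ (- s) * \sum_(j < m) riemannR s j.*2) @ \oo -->
    pi `^ (- s) * ((1 - 2 `^ (- s)) * zeta s).
  by apply: cvgM; [exact: cvg_cst|exact: odd_zeta].
rewrite [X in _ --> X](_ : _ =
    (0 + pi `^ (- s) * ((1 - 2 `^ (- s)) * zeta s)) * 2); last first.
  rewrite /midpoint_constant powRM ?ltW// !powRN add0r; field.
  by rewrite !gt_eqF ?powR_gt0.
have scvg : (fun m => (\sum_(j < m) d m j +
      pi `^ (- s) * \sum_(j < m) riemannR s j.*2) * 2) @ \oo -->
    (0 + pi `^ (- s) * ((1 - 2 `^ (- s)) * zeta s)) * 2.
  by apply: cvgM; [exact: cvgD|exact: cvg_cst].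
apply: cvg_trans scvg; apply: near_eq_cvg; exists 1%N => //= m m0.
rewrite midpoint_potential_double// [LHS]mulrC -mulrA; congr (_ * _).
rewrite /d sumrB mulr_sumr subrK mulr_suml.
by apply: eq_bigr => j _; rewrite -arc_kernel_scaled.
Qed.

Lemma cvg_midpoint_potential_pow2 (R : realType) (s : R) : 1 < s ->
  (fun n => midpoint_potential s (2 ^ n) / (2 ^ n)%:R `^ s) @ \oo -->
  midpoint_constant s.
Proof.
move=> s1; rewrite -cvg_shiftS.
have p2 : (fun n => 2 ^ n)%N @ \oo --> \oo.
  apply/cvgnyPge => A; exists A => //= n An.
  by apply: leq_trans An _; exact/ltnW/ltn_expl.
under eq_cvg do rewrite /= expnS mul2n -addnn.
exact: cvg_comp p2 (cvg_midpoint_potential s1).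
Qed.

(** * Power sums over binary digits and the set Theta *)

Lemma sum_pow2_lt (p m : nat) (e : 'I_p -> nat) :
  {homo e : k l / (k < l)%N >-> (l < k)%N} -> (forall k, (e k < m)%N) ->
  (\sum_(k < p) 2 ^ e k < 2 ^ m)%N.
Proof.
elim: p e m => [|p IH] e m edec em; first by rewrite big_ord0 expn_gt0.
have /IH h : {homo (fun k => e (lift ord0 k)) : k l / (k < l)%N >-> (l < k)%N}.
  by move=> k l kl; apply: edec; rewrite /= /bump /= !add1n ltnS.
rewrite big_ord_recl; apply: (@leq_trans (2 ^ (e ord0).+1)); last by rewrite leq_exp2l.
by rewrite expnS mul2n -addnn ltn_add2l h// => k; exact: edec.
Qed.

(** Uniqueness of the binary expansion: any decreasing list of exponents that
    adds up to [N] is the list of the digits of [N]. *)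
Lemma digit_sum_exponents (V : nmodType) (f : nat -> V) (p : nat) (e : 'I_p -> nat) :
  {homo e : k l / (k < l)%N >-> (l < k)%N} ->
  digit_sum f (\sum_(k < p) 2 ^ e k) = \sum_(k < p) f (e k).
Proof.
elim: p e => [|p IH] e edec; first by rewrite !big_ord0 digit_sum0.
have edec' : {homo (fun k => e (lift ord0 k)) : k l / (k < l)%N >-> (l < k)%N}.
  by move=> k l kl; apply: edec; rewrite /= /bump /= !add1n ltnS.
rewrite !big_ord_recl digit_sum_pow2D ?IH// sum_pow2_lt// => k; exact: edec.
Qed.

Lemma tau_b_digit_sum (N : nat) : tau_b N = digit_sum (fun=> 1%N) N.
Proof.
by rewrite /digit_sum [RHS]big_mkcond; apply: eq_bigr => i _; case: odd.
Qed.

Lemma binary_expansion (N : nat) : exists (p : nat) (e : 'I_p -> nat),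
  {homo e : k l / (k < l)%N >-> (l < k)%N} /\ N = (\sum_(k < p) 2 ^ e k)%N.
Proof.
suff [ds [dsort ->]] : exists ds : seq nat,
    sorted gtn ds /\ N = (\sum_(i <- ds) 2 ^ i)%N.
  exists (size ds), (fun k => nth 0%N ds k); split=> [k l kl|].
    have gtn_trans : transitive gtn by move=> x y z /= xy yz; exact: ltn_trans yz xy.
    by apply: (sorted_ltn_nth gtn_trans 0%N dsort); rewrite ?inE.
  by rewrite (big_nth 0%N) big_mkord.
elim/ltn_ind: N => -[_|N IH]; first by exists [::]; rewrite big_nil.
have /andP[n1 n2] := trunc_log_bounds (isT : (1 < 2)%N) (isT : (0 < N.+1)%N).
set n := trunc_log 2 N.+1 in n1 n2.
have lt2 : (N.+1 - 2 ^ n < 2 ^ n)%N.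
  by rewrite ltn_subLR// addnn -mul2n -expnS.
have [|ds [dsort dsE]] := IH (N.+1 - 2 ^ n)%N.
  by rewrite ltn_subrL expn_gt0.
exists (n :: ds); rewrite big_cons -dsE subnKC//; split=> //.
rewrite /= path_min_sorted//; apply/allP => i ids /=.
rewrite -(ltn_exp2l _ _ (isT : (1 < 2)%N)); apply: leq_ltn_trans lt2.
by rewrite dsE (big_rem i ids) leq_addr.
Qed.

Lemma digit_sum_pow2 (R : realType) (N : nat) :
  digit_sum (fun i => (2 ^ i)%:R : R) N = N%:R.
Proof.
by have [p [e [edec ->]]] := binary_expansion N; rewrite digit_sum_exponents// natr_sum.
Qed.

Lemma digit_sum_le (R : realType) (f g : nat -> R) (N : nat) :
  (forall i, (2 ^ i <= N)%N -> f i <= g i) -> digit_sum f N <= digit_sum g N.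
Proof.
move=> fg; apply: ler_sum => i odd_i; apply: fg; rewrite leqNgt.
by apply: contraL odd_i => iN; rewrite divn_small.
Qed.

Definition digit_power_sum (R : realType) (s : R) (N : nat) : R :=
  digit_sum (fun i => ((2 ^ i)%:R / N%:R) `^ s) N.

Lemma digit_sum_ratio (R : realType) (N : nat) : (0 < N)%N ->
  digit_sum (fun i => (2 ^ i)%:R / N%:R : R) N = 1.
Proof.
move=> N0; rewrite /digit_sum -mulr_suml -/(digit_sum (fun i => (2 ^ i)%:R) N).
by rewrite digit_sum_pow2 divff// pnatr_eq0 -lt0n.
Qed.

Lemma powR_ratio_le (R : realType) (s : R) (i N : nat) : 1 <= s ->
  (2 ^ i <= N)%N -> ((2 ^ i)%:R / N%:R) `^ s <= ((2 ^ i)%:R / N%:R : R).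
Proof.
move=> s1 iN; have N0 : (0 < N)%N by apply: leq_trans iN; rewrite expn_gt0.
apply: ge1r_powR => //; rewrite divr_gt0 ?ltr0n ?expn_gt0//=.
by rewrite ler_pdivrMr ?ltr0n// mul1r ler_nat.
Qed.

Lemma digit_power_sum_le1 (R : realType) (s : R) (N : nat) : 1 <= s ->
  (0 < N)%N -> digit_power_sum s N <= 1.
Proof.
move=> s1 N0; rewrite -(digit_sum_ratio R N0); apply: digit_sum_le => i.
exact: powR_ratio_le.
Qed.

Lemma digit_power_sum_pow2 (R : realType) (s : R) (n : nat) :
  digit_power_sum s (2 ^ n) = 1 :> R.
Proof.
rewrite /digit_power_sum -[X in digit_sum _ X]addn0 digit_sum_pow2D ?expn_gt0//.
rewrite digit_sum0 addr0.
by rewrite divff ?powR1// pnatr_eq0 expn_eq0.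
Qed.

Lemma digit_power_sum3_lt1 (R : realType) (s : R) : 1 < s ->
  digit_power_sum s 3 < 1.
Proof.
move=> s1; rewrite /digit_power_sum; set f := fun i => _.
have -> : digit_sum f 3 = f 1%N + f 0%N.
  rewrite [LHS](digit_sum_pow2D f (isT : (1 < 2 ^ 1)%N)); congr (_ + _).
  by rewrite [LHS](digit_sum_pow2D f (isT : (0 < 2 ^ 0)%N)) digit_sum0 addr0.
have f0 : f 0%N <= 3^-1.
  apply: le_trans (@powR_ratio_le R s 0 3 (ltW s1) isT) _.
  by rewrite expn0 mul1r.
have f1 : f 1%N < 2 / 3.
  rewrite /f expn1 -mulr_powRB1; [|lra..].
  rewrite gtr_pMr ?divr_gt0//; have h := @gt0_ltr_powR R (s - 1) _ (2 / 3) 1.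
  rewrite powR1 in h; apply: h; rewrite ?nnegrE; lra.
lra.
Qed.

(** The integers [2 ^ j * N] have the same digit ratios as [N], so the constant
    sequence of these ratios shows that they form a point of Theta. Hence the
    power sum of every single integer, not only their limits, is a value of
    [G]. *)
Lemma digit_power_sum_in_G (R : realType) (s : R) (N : nat) : (0 < N)%N ->
  exists2 theta : {p : nat & 'rV[R]_p}, theta \in @Theta R &
    G theta s = digit_power_sum s N.
Proof.
move=> N0; have [p [e [edec NE]]] := binary_expansion N.
exists (existT _ p (\row_k ((2 ^ e k)%:R / N%:R))); last first.
  have := digit_sum_exponents (fun i => ((2 ^ i)%:R / N%:R : R) `^ s) edec.
  rewrite -NE -/(digit_power_sum s N) => ->; rewrite /G /=.
  by apply: eq_bigr => k _; rewrite mxE.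
rewrite inE; exists p.
  rewrite /= lt0n; apply: contraTneq N0 => p0; move: e edec NE.
  by rewrite p0 => e _ ->; rewrite big_ord0.
exists (\row_k ((2 ^ e k)%:R / N%:R)) => //.
exists (fun j => 2 ^ j * N)%N, (fun j k => j + e k)%N.
have NjE j : (2 ^ j * N = \sum_(k < p) 2 ^ (j + e k))%N.
  by rewrite {1}NE big_distrr; apply: eq_bigr => k _; rewrite expnD.
have jdec j : {homo (fun k => j + e k)%N : k l / (k < l)%N >-> (l < k)%N}.
  by move=> k l kl; rewrite ltn_add2l edec.
split=> // [i j ij|j|k].
- by rewrite ltn_pmul2r// ltn_exp2l.
- rewrite muln_gt0 expn_gt0 N0 tau_b_digit_sum NjE digit_sum_exponents//; split=> //.
  by rewrite sum_nat_const card_ord muln1.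
- rewrite mxE; apply: cvg_trans (@cvg_cst _ _ _ \oo _).
  apply: near_eq_cvg; exists 0%N => // j _ /=.
  by rewrite expnD !natrM -mulf_div divff ?mul1r// pnatr_eq0 expn_eq0.
Qed.

(** The limit may be 0, where [x ^ s] is squeezed between 0 and [x]. *)
Lemma cvg_powR_unit (R : realType) (s l : R) (u : nat -> R) : 1 <= s ->
  (forall n, 0 < u n <= 1) -> u @ \oo --> l -> (fun n => u n `^ s) @ \oo --> l `^ s.
Proof.
move=> s1 u01 ul; have s0 : 0 < s by apply: lt_le_trans s1.
have : 0 <= l.
  rewrite -(cvg_lim _ ul)//; apply: limr_ge; first by apply/cvg_ex; exists l.
  by apply: nearW => n; have /andP[/ltW] := u01 n.
rewrite le_eqVlt => /predU1P[l0|]; last by move=> l0; exact: cvg_powR.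
rewrite -l0 powR0 ?gt_eqF//; rewrite -l0 in ul.
apply: (@squeeze_cvgr _ _ _ _ (fun=> 0) u) => //; last exact: cvg_cst.
by apply: nearW => n; rewrite powR_ge0/= ge1r_powR.
Qed.

Lemma cvg_digit_power_sum (R : realType) (s : R) (p : nat) (theta : 'rV[R]_p) :
  1 <= s -> @Theta_ R p theta ->
  exists N_ : nat -> nat, [/\ {homo N_ : i j / (i < j)%N},
    forall j, (0 < N_ j)%N &
    (fun j => digit_power_sum s (N_ j)) @ \oo --> \sum_(k < p) theta 0 k `^ s].
Proof.
move=> s1 [N_ [e [Ninc Ntau edec NE Ncvg]]]; exists N_.
split=> // [j|]; first exact: (Ntau j).1.
have -> : (fun j => digit_power_sum s (N_ j)) =
   (fun j => \sum_(k < p) ((2 ^ e j k)%:R / (N_ j)%:R : R) `^ s).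
  apply/funext => j.
  by have := digit_sum_exponents (fun i => ((2 ^ i)%:R / (N_ j)%:R : R) `^ s) (edec j);
    rewrite -NE.
apply: (cvg_big add_continuous) => k _.
apply: cvg_powR_unit => // j; have [N0 _] := Ntau j.
rewrite divr_gt0 ?ltr0n ?expn_gt0//= ler_pdivrMr ?ltr0n// mul1r ler_nat.
by rewrite [leqRHS]NE (bigD1 k)//= leq_addr.
Qed.

(** * Limit points, upper and lower limits *)

Lemma limn_esup_ub (R : realType) (u : nat -> \bar R) (l : R) :
  (forall e : R, 0 < e -> \forall n \near \oo, (u n <= (l + e)%:E)%E) ->
  (limn_esup u <= l%:E)%E.
Proof.
move=> h; apply/lee_addgt0Pr => e /h [n0 _ Hn]; rewrite limn_esup_lim.
apply: lime_le; first exact: is_cvg_esups.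
exists n0 => // n /= n0n; apply: ge_ereal_sup => _ [k /= nk <-].
by apply: Hn => /=; apply: leq_trans nk.
Qed.

Lemma limit_point_le_esup (R : realType) (u : nat -> \bar R) (l : \bar R) :
  limit_point_seq u l -> (l <= limn_esup u)%E.
Proof.
move=> [phi [phi_inc ul]].
have phi_ge n : (n <= phi n)%N.
  by elim: n => // n IH; apply: leq_ltn_trans IH _; exact: phi_inc.
rewrite limn_esup_lim -(cvg_lim _ ul)//; apply: lee_lim.
- by apply/cvg_ex; exists l.
- exact: is_cvg_esups.
- apply: nearW => n; apply: ereal_sup_ubound; exists (phi n) => //=.
Qed.

Lemma limit_point_seqN (R : realType) (u : nat -> \bar R) (l : \bar R) :
  limit_point_seq u l -> limit_point_seq (fun n => - u n)%E (- l)%E.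
Proof.
by move=> [phi [phi_inc ul]]; exists phi; split=> //; exact: cvgeN.
Qed.

Lemma limit_point_ge_einf (R : realType) (u : nat -> \bar R) (l : \bar R) :
  limit_point_seq u l -> (limn_einf u <= l)%E.
Proof.
by move=> /limit_point_seqN /limit_point_le_esup h; rewrite /limn_einf leeNl.
Qed.

Lemma limn_einf_lb (R : realType) (u : nat -> \bar R) (l : R) :
  (forall e : R, 0 < e -> \forall n \near \oo, ((l - e)%:E <= u n)%E) ->
  (l%:E <= limn_einf u)%E.
Proof.
move=> h; rewrite /limn_einf leeNr -EFinN; apply: limn_esup_ub => e /h.
by apply: filterS => n un; rewrite leeNl -EFinN opprD opprK.
Qed.

(** * The normalized greedy values *)

(** The weights [2 ^ i / N] of the digits of [N] add up to 1 and the digits below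
    any fixed position have negligible total weight, so this is an averaging
    of a null sequence along its tail. *)
Lemma weighted_digits_cvg0 (R : realType) (c : nat -> R) :
  (forall i, 0 <= c i) -> c @ \oo --> 0 ->
  (fun N => digit_sum (fun i => (2 ^ i)%:R / N%:R * c i) N) @ \oo --> 0.
Proof.
move=> c0 cl; apply/cvgr0Pnorm_le => e e0.
have e2 : 0 < e / 2 by rewrite divr_gt0.
have /cvgr0Pnorm_le /(_ _ e2) [m _ Hm] := cl.
(* [K] bounds the contribution of the digits below [m], before division by [N] *)
pose K := \sum_(i < m) (2 ^ i)%:R * c i.
have [N1 HN1] : exists N1 : nat, K / (e / 2) < N1%:R.
  exists (Num.bound (K / (e / 2))); apply: archi_boundP.
  by rewrite divr_ge0 ?(ltW e2)// sumr_ge0// => i _; rewrite mulr_ge0.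
exists (maxn m N1).+1 => //= N NN1; have N0 : (0 < N)%N by apply: leq_trans NN1.
have NR : (0 : R) < N%:R by rewrite ltr0n.
rewrite ger0_norm; last first.
  by apply: sumr_ge0 => i _; rewrite mulr_ge0// divr_ge0.
have mN : (m <= N)%N by apply: leq_trans NN1; rewrite leqW// leq_maxl.
pose w (i : nat) : R := if (i < m)%N then (2 ^ i)%:R * c i / N%:R else 0.
have w0 i : 0 <= w i by rewrite /w; case: ifP => // _; rewrite divr_ge0 ?mulr_ge0.
apply: (@le_trans _ _ (digit_sum (fun i => (2 ^ i)%:R / N%:R * (e / 2) + w i) N)).
  apply: digit_sum_le => i _; rewrite /w; case: ltnP => im.
    have -> : (2 ^ i)%:R * c i / N%:R = (2 ^ i)%:R / N%:R * c i by rewrite mulrAC.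
    by rewrite lerDr mulr_ge0 ?divr_ge0 ?(ltW e0).
  rewrite addr0 ler_wpM2l ?divr_ge0//.
  by have := Hm i im; rewrite ger0_norm.
rewrite /digit_sum big_split /= -mulr_suml -/(digit_sum (fun i => (2 ^ i)%:R / N%:R) N).
rewrite digit_sum_ratio// mul1r [leRHS]splitr lerD2l.
apply: (@le_trans _ _ (\sum_(i < N) w i)).
  by rewrite [leLHS]big_mkcond; apply: ler_sum => i _; case: ifP.
rewrite -big_mkcond/= -(big_ord_widen N (fun i => (2 ^ i)%:R * c i / N%:R) mN).
rewrite -mulr_suml -/K ler_pdivrMr// mulrC -ler_pdivrMr//.
apply: ltW; apply: lt_le_trans HN1 _; rewrite ler_nat.
by apply: leq_trans NN1; rewrite leqW// leq_maxr.
Qed.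

Section NormalizedValues.
Variables (R : realType) (s : R).
Hypothesis s1 : 1 < s.
Let C : R := midpoint_constant s.

Definition scaled_value (N : nat) : R := greedy_value s N / N%:R `^ s.

Lemma scaled_valueE (N : nat) : scaled_value N =
  digit_sum (fun i => ((2 ^ i)%:R / N%:R) `^ s *
                 (midpoint_potential s (2 ^ i) / (2 ^ i)%:R `^ s)) N.
Proof.
rewrite /scaled_value /greedy_value /digit_sum mulr_suml; apply: eq_bigr => i _.
have invE : N%:R^-1 `^ s = (N%:R `^ s)^-1 :> R.
  by rewrite -powR_inv1// -powRrM mulN1r powRN.
have p0 : (2 ^ i)%:R `^ s != 0 :> R by rewrite gt_eqF// powR_gt0// ltr0n expn_gt0.
rewrite powRM ?invr_ge0// invE; move: p0.
move: (_ `^ s) (midpoint_potential _ _) (_^-1) => p x q p0.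
by field.
Qed.

(** Digit by digit, the error is at most [2 ^ i / N] times the distance of the
    [i]-th scaled midpoint potential to its limit. *)
Lemma scaled_value_asymp :
  (fun N => scaled_value N - C * digit_power_sum s N) @ \oo --> 0.
Proof.
pose c i := `|midpoint_potential s (2 ^ i) / (2 ^ i)%:R `^ s - C|.
have c0 : c @ \oo --> 0.
  have h := cvg_midpoint_potential_pow2 s1; rewrite -(normr0 R) -(subrr C).
  by apply: cvg_norm; apply: cvgB; [exact: h|exact: cvg_cst].
have := weighted_digits_cvg0 (fun i => normr_ge0 _) c0.
move=> w0; apply/cvgr0Pnorm_le => e e0.
have /cvgr0Pnorm_le /(_ _ e0) [m _ Hm] := w0.
exists m => // N /= mN; apply: le_trans (Hm N mN).
apply: le_trans (ler_norm _).
have -> : scaled_value N - C * digit_power_sum s N =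
    digit_sum (fun i => ((2 ^ i)%:R / N%:R) `^ s *
                   (midpoint_potential s (2 ^ i) / (2 ^ i)%:R `^ s - C)) N.
  rewrite scaled_valueE /digit_power_sum /digit_sum mulr_sumr -sumrB.
  by apply: eq_bigr => i _; rewrite mulrBr [C * _]mulrC.
apply: le_trans (ler_norm_sum _ _ _) _.
apply: (@digit_sum_le R (fun i => `|((2 ^ i)%:R / N%:R) `^ s *
                   (midpoint_potential s (2 ^ i) / (2 ^ i)%:R `^ s - C)|)) => i iN.
by rewrite normrM ger0_norm ?powR_ge0// ler_wpM2r// powR_ratio_le// ltW.
Qed.

Lemma zeta_gt0 : 0 < zeta s.
Proof.
have s0 : 0 <= s by apply: ltW; apply: lt_trans s1.
apply: lt_le_trans (nondecreasing_cvgn_le (series_riemannR_ndecr s0)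
  (is_cvg_series_riemannR s1) 1).
by rewrite series_ord big_ord1 riemannR_gt0.
Qed.

Lemma midpoint_constant_gt0 : 0 < C.
Proof.
rewrite /C /midpoint_constant mulr_gt0 ?divr_gt0 ?mulr_gt0 ?zeta_gt0//;
  rewrite ?powR_gt0 ?mulr_gt0 ?pi_gt0//.
by rewrite subr_gt0 -invf_lt1 ?powR_gt0// -powRN powR2N_lt1// (lt_trans _ s1).
Qed.

Lemma G_ge0 (theta : {p : nat & 'rV[R]_p}) : 0 <= G theta s.
Proof. by apply: sumr_ge0 => k _; exact: powR_ge0. Qed.

Lemma g_lower_le (theta : {p : nat & 'rV[R]_p}) : theta \in @Theta R ->
  g_lower s <= G theta s.
Proof.
move=> th; apply: ge_inf; last by exists theta => //; exact/set_mem.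
by exists 0 => _ [th' _ <-]; exact: G_ge0.
Qed.

Lemma g_lower_le_digit (N : nat) : (0 < N)%N -> g_lower s <= digit_power_sum s N.
Proof. by move=> /(digit_power_sum_in_G s)[th thT <-]; exact: g_lower_le. Qed.

Lemma g_lower_lt1 : g_lower s < 1.
Proof.
exact: le_lt_trans (g_lower_le_digit (isT : (0 < 3)%N)) (digit_power_sum3_lt1 s1).
Qed.

Lemma g_lower_ge (x : R) :
  (forall theta : {p : nat & 'rV[R]_p}, theta \in @Theta R -> x <= G theta s) ->
  x <= g_lower s.
Proof.
move=> h; apply: lb_le_inf; last by move=> _ [th thT <-]; apply/h/mem_set.
have [th thT _] := @digit_power_sum_in_G R s 1 isT.
by exists (G th s), th => //; exact/set_mem.
Qed.

Lemma limit_point_of_digits (N_ : nat -> nat) (l : R) :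
  {homo N_ : i j / (i < j)%N} -> (forall j, (0 < N_ j)%N) ->
  (fun j => digit_power_sum s (N_ j)) @ \oo --> l ->
  limit_point_seq (fun n => (scaled_value n.+1)%:E) (l * C)%:E.
Proof.
move=> Ninc N0 Nl; exists (fun j => (N_ j).-1); split.
  by move=> i j /Ninc; have := N0 i; have := N0 j; lia.
have -> : (fun n => (scaled_value n.+1)%:E) \o (fun j => (N_ j).-1) =
    EFin \o (scaled_value \o N_) by apply/funext => j /=; rewrite prednK.
apply: cvg_EFin; first by apply: nearW.
have Ny : N_ @ \oo --> \oo.
  apply/cvgnyPge => A; exists A => //= n An; apply: leq_trans An _.
  by elim: n => // n IH; apply: leq_ltn_trans IH _; exact: Ninc.
have -> : fine \o (EFin \o (scaled_value \o N_)) =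
    fun j => (scaled_value (N_ j) - C * digit_power_sum s (N_ j)) +
             C * digit_power_sum s (N_ j).
  by apply/funext => j /=; rewrite subrK.
rewrite mulrC -[C * l]add0r; apply: cvgD.
  exact: cvg_comp Ny scaled_value_asymp.
by apply: cvgM => //; exact: cvg_cst.
Qed.

End NormalizedValues.

Theorem theorem1p7 (R : realType) (s : R) (hs : 1 < s) (a : nat -> R[i])
    (ha : greedy_energy_sequence s a) :
  [/\ exists M : R, forall n, (`| normalized_potential s a n | <= M%:E)%E,
      ~ cvgn (normalized_potential s a),
      limn_esup (normalized_potential s a) =
        ((2 `^ s - 1) * (2 * zeta s / (2 * pi) `^ s))%:E,
      limn_einf (normalized_potential s a) =
        (g_lower s * (2 `^ s - 1) * (2 * zeta s / (2 * pi) `^ s))%:E &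
      forall theta : {p : nat & 'rV[R]_p}, theta \in @Theta R ->
        limit_point_seq (normalized_potential s a)
          (G theta s * (2 `^ s - 1) * (2 * zeta s / (2 * pi) `^ s))%:E].
Proof.
have s0 : 0 < s by apply: lt_trans hs.
have uE : normalized_potential s a = fun n => (scaled_value s n.+1)%:E.
  apply/funext => n; rewrite /normalized_potential.
  by rewrite (greedy_potential_value s0 ha).
rewrite {}uE; set u : nat -> \bar R := fun n => _.
set C := (2 `^ s - 1) * (2 * zeta s / (2 * pi) `^ s).
have C0 : 0 < C := midpoint_constant_gt0 hs.
have diff0 : (fun n => scaled_value s n.+1 - C * digit_power_sum s n.+1) @ \oo --> 0.
  by have := scaled_value_asymp hs; rewrite -cvg_shiftS.
have near_diff e : 0 < e -> \forall n \near \oo,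
    C * digit_power_sum s n.+1 - e <= scaled_value s n.+1 <=
    C * digit_power_sum s n.+1 + e.
  move=> e0; have /cvgr0Pnorm_le /(_ _ e0) := diff0.
  by apply: filterS => n; rewrite ler_norml => /andP[h1 h2]; apply/andP; split; lra.
have lim_theta (theta : {p : nat & 'rV[R]_p}) : theta \in @Theta R ->
    limit_point_seq u (G theta s * C)%:E.
  rewrite inE => -[p p1 [th thT <-]].
  have [N_ [Ninc N0 Nl]] := cvg_digit_power_sum (ltW hs) thT.
  exact: limit_point_of_digits Ninc N0 Nl.
have lim1 : limit_point_seq u C%:E.
  rewrite -[C]mul1r; apply: (@limit_point_of_digits _ _ hs (fun j => 2 ^ j)%N).
  - by move=> i j ij; rewrite ltn_exp2l.
  - by move=> j; rewrite expn_gt0.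
  - under eq_cvg do rewrite digit_power_sum_pow2; exact: cvg_cst.
have supE : limn_esup u = C%:E.
  apply/eqP; rewrite eq_le limit_point_le_esup// andbT.
  apply: limn_esup_ub => e /near_diff; apply: filterS => n /andP[_ h].
  rewrite lee_fin; apply: le_trans h _; rewrite lerD2r ger_pMr//.
  exact: digit_power_sum_le1 (ltW hs) _.
have infE : limn_einf u = (g_lower s * C)%:E.
  apply/eqP; rewrite eq_le; apply/andP; split; last first.
    apply: limn_einf_lb => e /near_diff; apply: filterS => n /andP[h _].
    rewrite lee_fin; apply: le_trans h; rewrite lerB// mulrC ler_pM2l//.
    exact: g_lower_le_digit.
  case E : (limn_einf u) => [r| |]; last by rewrite leNye.
    rewrite lee_fin -ler_pdivrMr//; apply: g_lower_ge => th /lim_theta.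
    by move=> /limit_point_ge_einf; rewrite E lee_fin ler_pdivrMr.
  by have := limit_point_ge_einf lim1; rewrite E.
split.
- have /cvg_seq_bounded /pinfty_ex_gt0 [M M0 HM] := cvgP _ diff0.
  exists (M + C) => n; rewrite lee_fin.
  have : `|scaled_value s n.+1 - C * digit_power_sum s n.+1| <= M by exact: HM n I.
  rewrite !ler_norml => /andP[h1 h2].
  have := digit_power_sum_le1 (ltW hs) (ltn0Sn n).
  have : 0 <= digit_power_sum s n.+1 by apply: sumr_ge0 => i _; exact: powR_ge0.
  move=> d0 d1; apply/andP; split; nra.
- move=> cu; have := is_cvg_limn_einfE cu; rewrite -(is_cvg_limn_esupE cu).
  by rewrite supE infE => -[]; have := g_lower_lt1 hs; nra.
- exact: supE.
- by rewrite infE /C mulrA.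
- by move=> th /lim_theta; rewrite /C mulrA.
Qed.
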